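(* Let $0<\rho<1$, let $m$ be a positive integer, let $a_1,\ldots,a_m$ be real numbers, and let $Q_m:\sigma_\rho\to\sigma_\rho$ be the polynomial type operator $Q_m(x)=\left\{\sum_{i=1}^m a_it_n^i\right\}_{n=1}^\infty$ for $x=\{t_n\}_{n=1}^\infty\in\sigma_\rho$. Then $Q_m$ is Fréchet differentiable on $\sigma_\rho$, and for every $\bar x=\{\bar t_n\}_{n=1}^\infty\in\sigma_\rho$ its Fréchet derivative $\nabla Q_m(\bar x)$ at $\bar x$ is given as follows. (i) If $m>1$, then $\nabla Q_m(\bar x)$ is the infinite diagonal matrix with diagonal entries $\sum_{i=1}^m ia_i\bar t_n^{\,i-1}$, $n=1,2,\ldots$, i.e. $\nabla Q_m(\bar x)(x)=\left\{\sum_{i=1}^m ia_i\bar t_n^{\,i-1}t_n\right\}_{n=1}^\infty\in\sigma_\rho$ for every $x=\{t_n\}_{n=1}^\infty\in\sigma_\rho$. (ii) If $m=1$, then $\nabla Q_1(\bar x)$ is the infinite diagonal matrix with all diagonal entries $a_1$, i.e. $\nabla Q_1(\bar x)(x)=a_1x=\{a_1t_n\}_{n=1}^\infty\in\sigma_\rho$ for every $x=\{t_n\}_{n=1}^\infty\in\sigma_\rho$.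
   Context: Convention: $t^0=1$ for every real $t$. $\sigma_\rho$ is the real vector space of all real sequences $\{t_n\}_{n=1}^\infty$ with $\sum_{n=1}^\infty|t_n|^\rho<\infty$. For $k=1,2,\ldots$ define the $F$-seminorm $\|x\|_{\rho,k}=|t_k|^\rho$ for $x=\{t_n\}_{n=1}^\infty\in\sigma_\rho$. $\sigma_\rho$ carries the topology $\tau_\rho$ induced by the family $\mathbb{F}_{\sigma_\rho}=\{\|\cdot\|_{\rho,k}:k=1,2,\ldots\}$, i.e. the sets $\{x:\max\{p(x-x_0):p\in I\}<\lambda\}$, with $I$ a nonempty finite subset of $\mathbb{F}_{\sigma_\rho}$ and $\lambda>0$, form a base of neighborhoods of $x_0$. $\mathcal{F}_{\sigma_\rho}$ is the collection of nonempty finite subsets of $\mathbb{F}_{\sigma_\rho}$. Fréchet differentiability is with respect to this family: for $T:\sigma_\rho\to\sigma_\rho$ and $\bar x\in\sigma_\rho$, $T$ is Fréchet differentiable at $\bar x$ with Fréchet derivative $\nabla T(\bar x)=A$ if $A:\sigma_\rho\to\sigma_\rho$ is a continuous linear mapping such that for every $J\in\mathcal{F}_{\sigma_\rho}$ and $\varepsilon>0$ there are $I\in\mathcal{F}_{\sigma_\rho}$ and $\delta>0$ such that for all $u\in\sigma_\rho$: (DZ) if $\max\{p(u):p\in I\}=0$ then $\max\{q(T(\bar x+u)-T(\bar x)-A(u)):q\in J\}=0$; and (DR) if $0<\max\{p(u):p\in I\}<\delta$ then $\max\left\{q\left(\frac{T(\bar x+u)-T(\bar x)-A(u)}{\max\{p(u):p\in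 I\}}\right):q\in J\right\}<\varepsilon$. The equation $\nabla T(\bar x)=A$ is the assertion that $A$ has these properties. *)

(* Defs.v *)
From HB Require Import structures.
From mathcomp Require Import all_boot all_order all_algebra finmap.
From mathcomp Require Import all_classical all_reals all_analysis.

Set Implicit Arguments.
Unset Strict Implicit.
Unset Printing Implicit Defensive.

Import Order.TTheory GRing.Theory Num.Theory numFieldNormedType.Exports.

Local Open Scope classical_set_scope.
Local Open Scope ring_scope.

(* A sequence {t_n}_(n >= 1) is encoded as t : nat -> R, with t n standing for
   t_(n+1); accordingly the seminorms below are indexed from 0. *)

(* The proof of 0 < rho < 1 is a parameter of the space, as it is needed to
   infer the vector space and topological structures. *)
Definition rho_summable (R : realType) (rho : R) (rho01 : 0 < rho < 1) :
    {pred nat -> R} :=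
  fun t => (\sum_(0 <= n <oo) (`|t n| `^ rho)%:E < +oo)%E.

Record sigma_space (R : realType) (rho : R) (rho01 : 0 < rho < 1) := Sigma {
  seq_of :> nat -> R;
  seq_of_summable : seq_of \in rho_summable rho01 }.

Section vector_space.
Context (R : realType) (rho : R) (rho01 : 0 < rho < 1).

Local Notation S := (rho_summable rho01).

Let rho_gt0 : 0 < rho. Proof. by case/andP: rho01. Qed.
Let rho_lt1 : rho < 1. Proof. by case/andP: rho01. Qed.

Lemma powR_norm_subadd (a b : R) :
  `|a + b| `^ rho <= `|a| `^ rho + `|b| `^ rho.
Proof.
apply: (@le_trans _ _ ((`|a| + `|b|) `^ rho)).
  by apply: ge0_ler_powR; rewrite ?(ltW rho_gt0)// ?nnegrE ?addr_ge0 ?ler_normD.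
have [s0|s_gt0] := leP (`|a| + `|b|) 0.
  have -> : `|a| + `|b| = 0 by apply/le_anti; rewrite s0 addr_ge0.
  by rewrite powR0 ?gt_eqF// addr_ge0 ?powR_ge0.
set s := `|a| + `|b| in s_gt0 *.
have key (c : R) : 0 <= c -> c <= s -> c / s * s `^ rho <= c `^ rho.
  move=> c0 cs; have [->|c_neq0] := eqVneq c 0.
    by rewrite mul0r mul0r powR_ge0.
  have c_gt0 : 0 < c by rewrite lt_neqAle eq_sym c_neq0.
  have <- : (c / s) `^ rho * s `^ rho = c `^ rho.
    by rewrite -powRM ?divr_ge0// ?(ltW s_gt0)// divfK// gt_eqF.
  rewrite ler_wpM2r ?powR_ge0// ger1_powR ?(ltW rho_lt1)//.
  by rewrite divr_gt0//= ler_pdivrMr// mul1r.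
have -> : s `^ rho = `|a| / s * s `^ rho + `|b| / s * s `^ rho.
  by rewrite -mulrDl -mulrDl -/s divff ?mul1r// gt_eqF.
by apply: lerD; apply: key => //; rewrite ?lerDl ?lerDr.
Qed.

Lemma rho_summable_submod_closed : submod_closed S.
Proof.
split.
  rewrite unfold_in /rho_summable eseries0 ?ltry// => n _ _.
  by rewrite normr0 powR0 ?gt_eqF.
move=> a s t; rewrite !unfold_in /rho_summable => sS tS.
have nng (u : nat -> R) n : (0 <= (`|u n| `^ rho)%:E)%E.
  by rewrite lee_fin powR_ge0.
apply: (@le_lt_trans _ _ (\sum_(0 <= n <oo)
    ((`|a| `^ rho)%:E * (`|s n| `^ rho)%:E + (`|t n| `^ rho)%:E))%E).
  apply: lee_nneseries => n _ //.
  rewrite -EFinM -EFinD lee_fin -powRM// -normrM.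
  exact: powR_norm_subadd.
have a0 : (0 <= (`|a| `^ rho)%:E)%E by rewrite lee_fin powR_ge0.
rewrite nneseriesD => [|n _ _|n _ _]; rewrite ?mule_ge0//.
rewrite nneseriesZl//; apply: lte_add_pinfty => //.
by rewrite lte_mul_pinfty// lee_fin powR_ge0.
Qed.

HB.instance Definition _ := GRing.isSubmodClosed.Build _ _ S
  rho_summable_submod_closed.

HB.instance Definition _ := [isSub for @seq_of R rho rho01].
HB.instance Definition _ := [Choice of sigma_space rho01 by <:].
HB.instance Definition _ := [SubChoice_isSubLmodule of sigma_space rho01 by <:].

Lemma rho_summableM (s t : nat -> R) :
  s \in S -> t \in S -> (fun n => s n * t n) \in S.
Proof.
rewrite !unfold_in /rho_summable => sS tS.
have nng (u : nat -> R) n : (0 <= (`|u n| `^ rho)%:E)%E.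
  by rewrite lee_fin powR_ge0.
have s_fin : (\sum_(0 <= n <oo) (`|s n| `^ rho)%:E)%E \is a fin_num.
  by rewrite ge0_fin_numE// nneseries_ge0.
set K := fine (\sum_(0 <= n <oo) (`|s n| `^ rho)%:E)%E.
have K0 : 0 <= K by rewrite fine_ge0// nneseries_ge0.
have sK n : `|s n| `^ rho <= K.
  rewrite -lee_fin fineK//; apply: le_trans (nneseries_lim_ge n.+1 _) => //.
  by rewrite big_nat_recr//= leeDr// sume_ge0.
apply: (@le_lt_trans _ _ (\sum_(0 <= n <oo) (K%:E * (`|t n| `^ rho)%:E))%E).
  apply: lee_nneseries => n _ //.
  by rewrite -EFinM lee_fin normrM powRM// ler_wpM2r ?powR_ge0.
by rewrite nneseriesZl// lte_mul_pinfty.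
Qed.

Lemma rho_summableX (t : nat -> R) (i : nat) :
  (0 < i)%N -> t \in S -> (fun n => t n ^+ i) \in S.
Proof.
case: i => // i _ tS; elim: i => [|i IH].
  by rewrite (_ : (fun n => _) = t)//; apply/funext => n; rewrite expr1.
rewrite (_ : (fun n => _) = (fun n => t n * t n ^+ i.+1)); last first.
  by apply/funext => n; rewrite exprS.
exact: rho_summableM.
Qed.

Lemma rho_summable_poly (m : nat) (a : nat -> R) (t : nat -> R) :
  t \in S -> (fun n => \sum_(1 <= i < m.+1) a i * t n ^+ i) \in S.
Proof.
move=> tS.
rewrite (_ : (fun n => _) =
    \sum_(1 <= i < m.+1) a i *: (fun n => t n ^+ i : R)); last first.
  by apply/funext => n; rewrite fct_sumE.
rewrite big_nat; apply: rpred_sum => i /andP[i_gt0 _].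
by rewrite rpredZ// rho_summableX.
Qed.

End vector_space.

Section seminorms.
Context (R : realType) (rho : R) (rho01 : 0 < rho < 1).

Local Notation X := (sigma_space rho01).

Let rho_neq0 : rho != 0. Proof. by case/andP: rho01 => /gt_eqF ->. Qed.

Definition snorm (k : nat) : X -> R := fun x => `|x k| `^ rho.

Definition snorms : set (X -> R) := range snorm.

Definition fin_snorms : set {fset (X -> R)} :=
  [set I | I != fset0 /\ forall p, p \in I -> snorms p].

(* The F-seminorms are nonnegative, so the default value 0 does not affect the
   maximum over a nonempty I. *)
Definition max_snorm (I : {fset (X -> R)}) (u : X) : R :=
  \big[Num.max/0]_(p <- I) p u.

Lemma max_snorm_ltP (I : {fset (X -> R)}) (u : X) (l : R) : 0 < l ->
  (max_snorm I u < l) <-> (forall p, p \in I -> p u < l).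
Proof.
move=> l0; split=> [Il p pI|Il].
  by apply: le_lt_trans Il; rewrite /max_snorm; exact: le_bigmax_seq.
by rewrite /max_snorm big_seq; apply: bigmax_lt.
Qed.

Lemma max_snorm_subadd (I : {fset (X -> R)}) (u v : X) : fin_snorms I ->
  max_snorm I (u + v) <= max_snorm I u + max_snorm I v.
Proof.
move=> [_ IS].
have ge0 w : 0 <= max_snorm I w by exact: bigmax_ge_id.
rewrite [leLHS]/max_snorm big_seq; apply: bigmax_le; first by rewrite addr_ge0.
move=> p pI; have [k _ pk] := IS _ pI.
have le_max w : p w <= max_snorm I w by exact: le_bigmax_seq.
apply: le_trans (lerD (le_max u) (le_max v)).
by rewrite -pk; exact: powR_norm_subadd.
Qed.

Lemma max_snorm0 (I : {fset (X -> R)}) : fin_snorms I -> max_snorm I 0 = 0.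
Proof.
move=> [_ IS]; apply/le_anti/andP; split; last exact: bigmax_ge_id.
rewrite /max_snorm big_seq; apply: bigmax_le => // p /IS[k _ <-].
by rewrite /snorm normr0 powR0.
Qed.

Definition snorm_ball (I : {fset (X -> R)}) (x0 : X) (l : R) : set X :=
  [set x | max_snorm I (x - x0) < l].

Definition sigma_nbhs (x0 : X) : set_system X :=
  [set U | exists I l,
    [/\ fin_snorms I, 0 < l & snorm_ball I x0 l `<=` U]].

HB.instance Definition _ := hasNbhs.Build X sigma_nbhs.

Let sigma_nbhs_filter (x : X) : ProperFilter (nbhs x).
Proof.
split; first by move=> [I [l [IS l0 /(_ x)]]]; apply;
  rewrite /snorm_ball/= subrr max_snorm0.
split.
- exists [fset snorm 0%N]%fset, 1; split => //; split.
    by apply/fset0Pn; exists (snorm 0%N); rewrite inE.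
  by move=> p; rewrite inE => /eqP ->; exists 0%N.
- move=> U V [I [l [IS l0 IU]]] [J [k [JS k0 JV]]].
  exists (I `|` J)%fset, (Num.min l k).
  have m0 : 0 < Num.min l k by rewrite lt_min l0.
  split => //.
    split; last by move=> p; rewrite inE => /orP[/(proj2 IS)|/(proj2 JS)].
    have [/fset0Pn[p pI] _] := IS.
    by apply/fset0Pn; exists p; rewrite inE pI.
  move=> y /(max_snorm_ltP _ _ m0) yIJ; split; [apply: IU|apply: JV];
    apply/max_snorm_ltP => // p pI;
    have := yIJ p; rewrite inE pI ?orbT => /(_ erefl);
    by rewrite lt_min => /andP[].
- move=> U V UV [I [l [IS l0 IU]]]; exists I, l; split => //.
  exact: subset_trans UV.
Qed.

Let sigma_nbhs_singleton (x : X) (U : set X) : nbhs x U -> U x.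
Proof.
move=> [I [l [IS l0]]]; apply.
by rewrite /snorm_ball/= subrr max_snorm0.
Qed.

Let sigma_nbhs_nbhs (x : X) (U : set X) : nbhs x U -> nbhs x (nbhs^~ U).
Proof.
move=> [I [l [IS l0 IU]]]; exists I, l; split => // y.
rewrite /snorm_ball/= => yl.
exists I, (l - max_snorm I (y - x)); split; rewrite ?subr_gt0// => z.
rewrite /snorm_ball/= ltrBrDr => zl; apply: IU; rewrite /snorm_ball/=.
apply: le_lt_trans zl.
have -> : z - x = (z - y) + (y - x) by rewrite addrA subrK.
exact: max_snorm_subadd.
Qed.

HB.instance Definition _ := Nbhs_isNbhsTopological.Build X
  sigma_nbhs_filter sigma_nbhs_singleton sigma_nbhs_nbhs.

Definition is_frechet_derivative (T : X -> X) (xbar : X) (A : X -> X) : Prop :=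
  [/\ linear A, continuous A &
    forall J eps, fin_snorms J -> 0 < eps ->
    exists I delta, [/\ fin_snorms I, 0 < delta & forall u : X,
      (max_snorm I u = 0 -> max_snorm J (T (xbar + u) - T xbar - A u) = 0) /\
      (0 < max_snorm I u < delta ->
       max_snorm J ((max_snorm I u)^-1 *: (T (xbar + u) - T xbar - A u))
         < eps)]].

Definition frechet_differentiable (T : X -> X) (xbar : X) : Prop :=
  exists A, is_frechet_derivative T xbar A.

Definition is_diagonal (A : X -> X) (d : nat -> R) : Prop :=
  forall (x : X) n, A x n = d n * x n.

Definition Qpoly (m : nat) (a : nat -> R) (x : X) : X :=
  Sigma (rho_summable_poly m a (seq_of_summable x)).

End seminorms.

(* Main.v *)
(* The operator acts coordinatewise, so its derivative should be multiplication
   by the derivatives of the polynomial at the coordinates of xbar.  These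
   coordinates are bounded, hence so are the diagonal entries, and the Taylor
   remainder is at most C |u_n|^2 with C independent of n.  Take I = J and put
   M = max_J |u_n|^rho <= 1.  For the coordinates occurring in J,
   |u_n| <= |u_n|^rho <= M because rho < 1, so the remainder divided by M is at
   most C M in absolute value, which tends to 0 with M. *)
Require Import Defs.
From mathcomp Require Import all_boot all_order all_algebra.
From mathcomp Require Import all_classical all_reals all_analysis.
From mathcomp Require Import finmap ring.
Import Order.TTheory GRing.Theory Num.Theory numFieldNormedType.Exports.
Local Open Scope ring_scope.

(** By induction on [i]: multiplying the remainder of degree [i] by [t + u] gives the next remainder
    up to the quadratic term [i%:R * t ^+ i.-1 * u ^+ 2]. *)
Lemma exprD_taylor1 (R : realType) (K : R) (i : nat) : 0 <= K ->
  exists2 C : R, 0 <= C & forall t u : R, `|t| <= K -> `|u| <= 1 ->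
    `|(t + u) ^+ i - t ^+ i - i%:R * t ^+ i.-1 * u| <= C * `|u| ^+ 2.
Proof.
move=> K0; elim: i => [|i [C C0 IH]].
  by exists 0 => // t u _ _; rewrite !expr0 subrr !mul0r subrr normr0.
(* [K + 1] bounds [t + u]; the second summand bounds the coefficient of the extra [u ^+ 2]. *)
exists ((K + 1) * C + i%:R * K ^+ i.-1).
  by rewrite addr_ge0 ?mulr_ge0 ?addr_ge0 ?exprn_ge0.
move=> t u tK u1.
have -> : (t + u) ^+ i.+1 - t ^+ i.+1 - i.+1%:R * t ^+ i.+1.-1 * u =
    (t + u) * ((t + u) ^+ i - t ^+ i - i%:R * t ^+ i.-1 * u)
    + i%:R * t ^+ i.-1 * u ^+ 2.
  (* At [i = 0] the truncated [i.-1] is harmless, since its coefficient [i%:R] vanishes. *)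
  case: i {C C0 IH} => [|i] /=; first by rewrite !expr0 !expr1; ring.
  by rewrite -!natr1 !exprS; ring.
apply: le_trans (ler_normD _ _) _; rewrite [leRHS]mulrDl.
apply: lerD.
  rewrite normrM -[leRHS]mulrA; apply: ler_pM => //; last exact: IH.
  by apply: le_trans (ler_normD _ _) _; exact: lerD.
rewrite !normrM !normrX normr_nat ler_wpM2r ?exprn_ge0//.
by rewrite ler_wpM2l// lerXn2r// nnegrE.
Qed.

(** [C] depends on [t] only through [K], so one constant will serve all coordinates of a bounded
    sequence. *)
Lemma poly_taylor1 (R : realType) (m : nat) (a : nat -> R) (K : R) : 0 <= K ->
  exists2 C : R, 0 <= C & forall t u : R, `|t| <= K -> `|u| <= 1 ->
    `|\sum_(1 <= i < m.+1) a i * (t + u) ^+ i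
      - \sum_(1 <= i < m.+1) a i * t ^+ i
      - (\sum_(1 <= i < m.+1) i%:R * a i * t ^+ i.-1) * u| <= C * `|u| ^+ 2.
Proof.
move=> K0.
have /choice[C CP] i : exists c : R, 0 <= c /\
    forall t u : R, `|t| <= K -> `|u| <= 1 ->
    `|(t + u) ^+ i - t ^+ i - i%:R * t ^+ i.-1 * u| <= c * `|u| ^+ 2.
  by have [c c0 cP] := @exprD_taylor1 _ K i K0; exists c.
exists (\sum_(1 <= i < m.+1) `|a i| * C i).
  by apply: sumr_ge0 => i _; rewrite mulr_ge0//; case: (CP i).
move=> t u tK u1; rewrite !mulr_suml -!sumrB.
apply: le_trans (ler_norm_sum _ _ _) _; apply: ler_sum => i _.
have -> : a i * (t + u) ^+ i - a i * t ^+ i - i%:R * a i * t ^+ i.-1 * u =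
    a i * ((t + u) ^+ i - t ^+ i - i%:R * t ^+ i.-1 * u) by ring.
by rewrite normrM -[leRHS]mulrA ler_wpM2l//; apply: (CP i).2.
Qed.

Section diagonal_operators.
Context {R : realType} {rho : R} {rho01 : 0 < rho < 1}.
Implicit Types (x u v : sigma_space rho01) (I : {fset (sigma_space rho01 -> R)}).

Let rho_gt0 : 0 < rho. Proof. by case/andP: rho01. Qed.

Definition bounded_seq (d : nat -> R) :=
  exists2 D : R, 0 <= D & forall n, `|d n| <= D.

(** Each [|x n| ^ rho] is at most the whole sum [s]; taking [rho]-th roots gives the bound
    [s ^ (1 / rho)]. *)
Lemma sigma_bounded x : bounded_seq x.
Proof.
have := seq_of_summable x; rewrite unfold_in /rho_summable => xS.
have nng n : (0 <= (`|x n| `^ rho)%:E)%E by rewrite lee_fin powR_ge0.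
set s := (\sum_(0 <= n <oo) _)%E in xS.
have s_ge0 : (0 <= s)%E by apply: nneseries_ge0.
have s_fin : s \is a fin_num by rewrite ge0_fin_numE.
exists (fine s `^ rho^-1) => [|n]; first exact: powR_ge0.
have xs : `|x n| `^ rho <= fine s.
  rewrite -lee_fin fineK//; apply: le_trans (nneseries_lim_ge n.+1 _) => //.
  by rewrite big_nat_recr//= leeDr// sume_ge0.
have -> : `|x n| = (`|x n| `^ rho) `^ rho^-1.
  by rewrite -powRrM mulfV ?powRr1// gt_eqF.
by apply: ge0_ler_powR; rewrite ?nnegrE ?powR_ge0 ?fine_ge0 ?invr_ge0 ?(ltW rho_gt0).
Qed.

Lemma bounded_diag_summable (d : nat -> R) x : bounded_seq d ->
  (fun n => d n * x n) \in rho_summable rho01.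
Proof.
move=> [D D0 dD]; have := seq_of_summable x.
rewrite !unfold_in /rho_summable => xS.
apply: (@le_lt_trans _ _
    (\sum_(0 <= n <oo) ((D `^ rho)%:E * (`|x n| `^ rho)%:E))%E).
  apply: lee_nneseries => n _; first by rewrite lee_fin powR_ge0.
  rewrite -EFinM lee_fin normrM powRM// ler_wpM2r ?powR_ge0//.
  by apply: ge0_ler_powR; rewrite ?nnegrE ?(ltW rho_gt0).
rewrite nneseriesZl => [|n _]; last by rewrite lee_fin powR_ge0.
by rewrite lte_mul_pinfty// lee_fin powR_ge0.
Qed.

Definition diag {d : nat -> R} (db : bounded_seq d) x : sigma_space rho01 :=
  Sigma (bounded_diag_summable d x db).

Lemma diag_is_linear (d : nat -> R) (db : bounded_seq d) : linear (diag db).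
Proof.
move=> c u v; apply/val_inj/funext => n /=.
by rewrite /= mulrDr mulrCA.
Qed.

Lemma le_max_snorm I u k : snorm k \in I -> `|u k| `^ rho <= max_snorm I u.
Proof.
have le_max p : p \in I -> p u <= max_snorm I u.
  by move=> pI; exact: le_bigmax_seq.
exact: le_max.
Qed.

Lemma max_snorm_le I u (l : R) : fin_snorms I -> 0 <= l ->
  (forall k, snorm k \in I -> `|u k| `^ rho <= l) -> max_snorm I u <= l.
Proof.
move=> [_ IS] l0 ul; rewrite /max_snorm big_seq; apply: bigmax_le => // p pI.
by have [k _ pk] := IS _ pI; rewrite -pk; apply: ul; rewrite pk.
Qed.

Lemma max_snorm_ge0 I u : 0 <= max_snorm I u.
Proof. exact: bigmax_ge_id. Qed.

Lemma diag_continuous (d : nat -> R) (db : bounded_seq d) :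
  continuous (diag db).
Proof.
move=> x U [J [l [JS l0 JU]]]; have [D D0 dD] := db.
(* The operator enlarges each seminorm by a factor at most [D ^ rho]; the [+ 1] keeps the divisor
   positive. *)
exists J, (l / (D `^ rho + 1)).
have D1 : 0 < D `^ rho + 1 by rewrite ltr_wpDl ?powR_ge0.
split=> //; first by rewrite divr_gt0.
move=> y; rewrite /snorm_ball/= ltr_pdivlMr// => yl; apply: JU.
rewrite /snorm_ball/=; apply: le_lt_trans yl.
apply: max_snorm_le => //.
  by rewrite mulr_ge0 ?max_snorm_ge0 ?ltW.
move=> k kJ.
have -> : (diag db y - diag db x) k = d k * (y - x) k.
  by rewrite /= /= mulrBr.
rewrite normrM powRM// mulrC; apply: ler_pM; rewrite ?powR_ge0//.
  exact: le_max_snorm.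
rewrite ler_wpDr//.
by apply: ge0_ler_powR; rewrite ?nnegrE ?(ltW rho_gt0).
Qed.

Lemma is_frechet_derivative_diag (T : sigma_space rho01 -> sigma_space rho01) x
    (d : nat -> R) (db : bounded_seq d) (C : R) : 0 <= C ->
  (forall u n, `|u n| <= 1 ->
     `|(T (x + u) - T x - diag db u) n| <= C * `|u n| ^+ 2) ->
  is_frechet_derivative T x (diag db).
Proof.
move=> C0 TC; split; [exact: diag_is_linear|exact: diag_continuous|].
(* Seminorms are [rho]-th powers of absolute values, so a seminorm is below [eps] exactly when the
   coordinate is below [e] in absolute value. *)
move=> J eps JS eps0; set e := eps `^ rho^-1.
have e0 : 0 < e by rewrite powR_gt0.
have C1 : 0 < C + 1 by rewrite ltr_wpDl.
(* The bound 1 makes [uM] applicable; the other bound gives [C * M < e], even for [C = 0]. *)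
exists J, (Num.min 1 (e / (C + 1))); split=> //.
  by rewrite lt_min ltr01 divr_gt0.
move=> u; set M := max_snorm J u; set r := T (x + u) - T x - diag db u.
have uM k : snorm k \in J -> M <= 1 -> `|u k| <= M /\ `|u k| <= 1.
  move=> kJ M1; have uMk := le_max_snorm J u k kJ.
  have u1 : `|u k| <= 1.
    (* If [|u k| > 1], then [|u k| ^ rho > 1], against [|u k| ^ rho <= M <= 1]. *)
    rewrite leNgt; apply/negP => u1.
    have := le_trans uMk M1; rewrite leNgt => /negP; apply.
    rewrite (_ : 1 = 1 `^ rho); last by rewrite powR1.
    by apply: gt0_ltr_powR; rewrite ?nnegrE.
  split=> //; apply: le_trans uMk.
  have [->|u0] := eqVneq (`|u k|) 0; first exact: powR_ge0.
  rewrite ger1_powR ?(ltW (andP rho01).2)//.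
  by rewrite u1 lt_neqAle eq_sym u0 normr_ge0.
split=> [M0|/andP[M0]].
  (* Condition (DZ): [M = 0] forces [u k = 0] at every index of [J], and the quadratic bound then
     kills the remainder there. *)
  apply/le_anti; rewrite max_snorm_ge0 andbT; apply: max_snorm_le => // k kJ.
  have [|uk0 uk1] := uM k kJ; first by rewrite M0.
  have uk : `|u k| = 0 by apply/le_anti; rewrite normr_ge0 andbT -M0.
  have := TC u k uk1; rewrite uk expr0n mulr0 -/r => rk.
  have -> : `|r k| = 0 by apply/le_anti; rewrite rk normr_ge0.
  by rewrite powR0// gt_eqF.
rewrite lt_min ltr_pdivlMr// => /andP[M1 Me].
have CM : C * M < e by apply: le_lt_trans Me; rewrite mulrC ler_pM2l// lerDl.
apply: (@le_lt_trans _ _ ((C * M) `^ rho)); last first.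
  have -> : eps = e `^ rho by rewrite /e -powRrM mulVf ?powRr1 ?gt_eqF// ltW.
  by apply: gt0_ltr_powR; rewrite ?nnegrE ?mulr_ge0// ?ltW.
apply: max_snorm_le; rewrite ?powR_ge0// => k kJ.
have [ukM uk1] := uM k kJ (ltW M1).
have -> : (M^-1 *: r) k = M^-1 * r k by [].
apply: ge0_ler_powR; rewrite ?nnegrE ?mulr_ge0// ?(ltW rho_gt0) ?(ltW M0)//.
rewrite normrM gtr0_norm ?invr_gt0// mulrC ler_pdivrMr//.
(* One factor [M] of [C * M ^+ 2] absorbs the division by [M]. *)
apply: le_trans (TC u k uk1) _; rewrite -mulrA -expr2 ler_wpM2l//.
by rewrite lerXn2r// nnegrE ltW.
Qed.

Lemma poly_deriv_bounded (m : nat) (a : nat -> R) x :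
  bounded_seq (fun n => \sum_(1 <= i < m.+1) i%:R * a i * x n ^+ i.-1).
Proof.
have [K K0 xK] := sigma_bounded x.
exists (\sum_(1 <= i < m.+1) `|i%:R * a i| * K ^+ i.-1).
  by apply: sumr_ge0 => i _; rewrite mulr_ge0 ?exprn_ge0.
move=> n; apply: le_trans (ler_norm_sum _ _ _) _; apply: ler_sum => i _.
by rewrite normrM normrX ler_wpM2l// lerXn2r// nnegrE.
Qed.

Lemma Qpoly_derivative (m : nat) (a : nat -> R) x :
  is_frechet_derivative (Qpoly m a) x (diag (poly_deriv_bounded m a x)).
Proof.
have [K K0 xK] := sigma_bounded x.
have [C C0 CP] := @poly_taylor1 _ m a K K0.
apply: (@is_frechet_derivative_diag _ _ _ _ C) => // u n u1.
exact: (CP (x n) (u n) (xK n) u1).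
Qed.

End diagonal_operators.

Theorem theorem6p6 (R : realType) (rho : R) (rho01 : 0 < rho < 1)
    (m : nat) (m_gt0 : (0 < m)%N) (a : nat -> R) :
  (forall xbar : sigma_space rho01,
     frechet_differentiable (Qpoly m a) xbar) /\
  (forall xbar : sigma_space rho01,
     ((1 < m)%N ->
        exists A : sigma_space rho01 -> sigma_space rho01,
          [/\ is_frechet_derivative (Qpoly m a) xbar A,
              is_diagonal A
                (fun n => \sum_(1 <= i < m.+1) i%:R * a i * xbar n ^+ i.-1)
            & forall (x : sigma_space rho01) (n : nat),
                A x n =
                \sum_(1 <= i < m.+1) i%:R * a i * xbar n ^+ i.-1 * x n]) /\
     (m = 1%N ->
        exists A : sigma_space rho01 -> sigma_space rho01,
          [/\ is_frechet_derivative (Qpoly m a) xbar A,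
              is_diagonal A (fun=> a 1%N),
              forall x : sigma_space rho01, A x = a 1%N *: x
            & forall (x : sigma_space rho01) (n : nat),
                A x n = a 1%N * x n])).
Proof.
have frechet := Qpoly_derivative m a.
split=> [xbar|xbar]; first by exists (diag (poly_deriv_bounded m a xbar)).
split=> [_|m1]; exists (diag (poly_deriv_bounded m a xbar)).
  by split=> // x n; rewrite -mulr_suml.
have diagE (x : sigma_space rho01) n :
    diag (poly_deriv_bounded m a xbar) x n = a 1%N * x n.
  (* Only [i = 1] remains, and [xbar n ^+ 0 = 1] even where [xbar n = 0]. *)
  by rewrite /= m1 big_nat1 mul1r expr0 mulr1.
split=> // x; apply/val_inj/funext => n; exact: diagE.
Qed.
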